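(* There is an absolute constant $C>0$ such that the following holds. Let $\varepsilon\in(0,1)$, $\eta\in(0,1)$, let $b'\ge1$ be an integer, and let \[ b\ \ge\ \frac{(1+\eta)^2}{1-\eta}\,b'+C\,\frac{\log n}{\eta^2\varepsilon}. \] There is an $\varepsilon$-LEDP algorithm in the billboard model that, on any $n$-vertex input graph $G$, with high probability outputs an implicit $b$-matching whose size is at least $\frac12\mathrm{OPT}_{b'}(G)$, where $\mathrm{OPT}_{b'}(G)$ is the size of a maximum $b'$-matching of $G$.
   Context: A $b$-matching of $G=(V,E)$ is a set of edges in which every vertex is incident to at most $b$ edges. Local edge differential privacy (LEDP): each node knows only its own adjacency list; the computation proceeds in rounds in which chosen nodes apply local randomizers (algorithms whose input is the node's adjacency list, possibly depending on the public transcript so far, and which are edge-DP with respect to changing one entry of that list) and the outputs are appended to a public transcript; the protocol is $\varepsilon$-LEDP if the map from the input graph to the entire transcript is $\varepsilon$-edge differentially private (edge-neighboring graphs differ in one edge). Billboard model: the public transcript is the billboard, and each node $v$ decodes its part of the solution by a deterministic function of the billboard and its own neighborhood $N(v)$. An implicit solution is $\mathcal S=\{S_v\}_{v\in V}$, $S_v\subseteq V$, defining $H(\mathcal S)$ with edges $\{u,v\}$ such that $u\in S_v$ or $v\in S_u$; the implicit graph is $G\cap H(\mathcal S)$. An implicit $b$-matching is an implicit solution whose implicit graph has maximum degree at most $b$; its size is the number of edges of the implicit graph. ''With high probability'' means with probability at least $1-n^{-c}$ for a constant $c\ge1$ (the hidden constants may depend on $c$). *)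

(* Defs.v *)
From HB Require Import structures.
From mathcomp Require Import all_boot all_order all_algebra.
From mathcomp Require Import all_classical all_reals all_analysis.

Set Implicit Arguments.
Unset Strict Implicit.
Unset Printing Implicit Defensive.

Import Order.TTheory GRing.Theory Num.Theory.
Local Open Scope classical_set_scope.
Local Open Scope ring_scope.

Section Graphs.
Variable V : finType.

Record sgraph := SGraph {
  adj : rel V;
  adj_sym : symmetric adj;
  adj_irrefl : irreflexive adj }.

Definition nbhd (G : sgraph) (v : V) : {set V} := [set u | adj G v u]%SET.

Definition edges (G : sgraph) : {set {set V}} :=
  [set e : {set V} | [exists u, exists v, adj G u v && (e == [set u; v])]]%SET.

Definition max_degree (G : sgraph) : nat := \max_(v : V) #|nbhd G v|.

Definition b_matching (G : sgraph) (b : nat) (M : {set {set V}}) : bool :=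
  (M \subset edges G) && [forall v, #|[set e in M | v \in e]%SET| <= b]%N.

Definition opt (G : sgraph) (b : nat) : nat :=
  \max_(M : {set {set V}} | b_matching G b M) #|M|.

Definition differ_in_one (T : finType) (A B : {set T}) : Prop :=
  #|((A :\: B) :|: (B :\: A))%SET| = 1%N.

Definition edge_neighboring (G G' : sgraph) : Prop :=
  differ_in_one (edges G) (edges G').

Definition implicit_solution := V -> {set V}.

Definition implicit_adj (G : sgraph) (S : implicit_solution) : rel V :=
  fun u v => adj G u v && ((u \in S v) || (v \in S u)).

Lemma implicit_adj_sym G S : symmetric (implicit_adj G S).
Proof. by move=> u v; rewrite /implicit_adj adj_sym orbC. Qed.

Lemma implicit_adj_irrefl G S : irreflexive (implicit_adj G S).
Proof. by move=> u; rewrite /implicit_adj adj_irrefl. Qed.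

Definition implicit_graph (G : sgraph) (S : implicit_solution) : sgraph :=
  SGraph (@implicit_adj_sym G S) (@implicit_adj_irrefl G S).

Definition implicit_b_matching (G : sgraph) (b : nat) (S : implicit_solution)
  : Prop := (max_degree (implicit_graph G S) <= b)%N.

Definition implicit_size (G : sgraph) (S : implicit_solution) : nat :=
  #|edges (implicit_graph G S)|.

End Graphs.

Section Distributions.
Variable R : realType.

Definition mass (T : choiceType) (p : T -> R) (A : set T) : \bar R :=
  \esum_(x in A) (p x)%:E.

(* Discrete distributions: summability forces the support to be countable, even
   though T may be any choiceType. *)
Record dist (T : choiceType) := Dist {
  pmf :> T -> R;
  pmf_ge0 : forall x, 0 <= pmf x;
  pmf_mass1 : mass pmf setT = 1%E }.

(* p and q are the mass functions of the outputs on two neighboring inputs. *)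
Definition dp_close (T : choiceType) (eps : R) (p q : T -> R) : Prop :=
  forall A : set T, (mass p A <= (expR eps)%:E * mass q A)%E.

End Distributions.

Section LEDP.
Variables (R : realType) (V : finType).

(* The adjacency list of a node is the set of its neighbors, equivalently the
   corresponding 0/1 row of the adjacency matrix; changing one entry adds or
   removes one neighbor. *)
Record local_randomizer (Y : choiceType) := LocalRandomizer {
  randomize :> {set V} -> dist R Y;
  lr_eps : R;
  lr_eps_ge0 : 0 <= lr_eps;
  lr_dp : forall N N' : {set V}, differ_in_one N N' ->
    dp_close lr_eps (randomize N) (randomize N') }.

(* One entry per round, listing the outputs of that round; None marks the nodes
   that were not chosen. The chosen nodes, their randomizers and their privacy
   parameters are not recorded: they are functions of the earlier outputs. *)
Definition transcript (Y : choiceType) : choiceType :=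
  seq {ffun V -> option Y}.

(* The next round as a function of the public transcript: None halts the
   computation, and otherwise each node is either idle (None) or assigned a
   local randomizer. *)
Definition strategy (Y : choiceType) : Type :=
  transcript Y -> option (V -> option (local_randomizer Y)).

Section Semantics.
Variables (Y : choiceType) (next : strategy Y) (G : sgraph V).

(* Given the transcript h, the probability that the next round produces the
   outputs m; the chosen nodes use independent randomness. *)
Definition round_pmf (h : transcript Y) (m : {ffun V -> option Y}) : R :=
  if next h is Some chosen then
    \prod_(v : V) match chosen v, m v with
                  | Some r, Some y => r (nbhd G v) y
                  | None, None => 1
                  | _, _ => 0
                  end
  else 0.

(* Given the transcript h, the probability that the remaining rounds append
   exactly s and that the computation then halts. *)
Fixpoint run_pmf (h s : transcript Y) : R :=
  match s with
  | [::] => if next h is None then 1 else 0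
  | m :: s' => round_pmf h m * run_pmf (rcons h m) s'
  end.

Definition transcript_pmf : transcript Y -> R := run_pmf [::].

End Semantics.

(* A billboard algorithm: the interactive protocol together with the
   deterministic decoder used by each node v on the billboard and its own
   neighborhood. The protocol must halt almost surely on every graph. *)
Record algorithm := Algorithm {
  msg : choiceType;
  next_round : strategy msg;
  halts : forall G : sgraph V, mass (transcript_pmf next_round G) setT = 1%E;
  node_decoder : transcript msg -> V -> {set V} -> {set V} }.

Arguments next_round : clear implicits.
Arguments node_decoder : clear implicits.

Definition billboard_prob (alg : algorithm) (G : sgraph V)
    (E : set (transcript (msg alg))) : \bar R :=
  mass (transcript_pmf (next_round alg) G) E.

Definition ledp (eps : R) (alg : algorithm) : Prop :=
  forall G G' : sgraph V, edge_neighboring G G' ->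
    dp_close eps (transcript_pmf (next_round alg) G)
                 (transcript_pmf (next_round alg) G').

Definition output (alg : algorithm) (G : sgraph V)
    (p : transcript (msg alg)) : implicit_solution V :=
  fun v => node_decoder alg p v (nbhd G v).

End LEDP.

Arguments billboard_prob {R V} alg G E.
Arguments output {R V} alg G p _.

(* Main.v *)
Require Import Defs.
From HB Require Import structures.
From mathcomp Require Import all_boot all_order all_algebra.
From mathcomp Require Import all_classical all_reals all_analysis.
From mathcomp Require Import zify ring lra.

Set Implicit Arguments.
Unset Strict Implicit.
Unset Printing Implicit Defensive.

Import Order.TTheory GRing.Theory Num.Theory.
Local Open Scope classical_set_scope.
Local Open Scope ring_scope.

(** Every node keeps running a stopping test until it stops. The pairs {u, v}
    with u + v = i are processed in round i, and an edge is kept when both of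
    its endpoints are still running before its round. If a_i = exp (e0 * d_i),
    where d_i is the number of edges kept so far at the node, then the node
    survives the tests of rounds 0, ..., i - 1 with probability K / (K + A_i)
    for A_i = a_0 + ... + a_(i-1): it stops in round i with conditional
    probability a_i / (K + A_i + a_i). Changing one entry of the adjacency list
    changes a_i and K + A_i by a factor of at most exp e0, hence the
    probability of any sequence of answers of a node by at most exp (3 e0); an
    edge has two endpoints, so the transcript is 6 e0 private.

    A node stops with d_i < b' with probability at most
    T exp (e0 b') / K over T rounds, and 1_(running) (K + A_i) is a martingale,
    so a node survives a test with d_i >= b with probability at most
    K exp (- e0 b). Outside these events all degrees are at most b, and every
    edge that is not kept has an endpoint of degree at least b', so that a
    double counting of the edges of a maximum b'-matching gives the factor 1/2.
    The additive loss b - b' is O(log n / eps), with no multiplicative loss. *)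

(** * Edges, degrees and the factor 1/2 *)

Section Graphs.
Variable V : finType.
Implicit Types (F G : sgraph V) (M X : {set {set V}}).

Lemma set2_eq_r (x y v : V) : [set x; v]%SET = [set y; v]%SET -> x = y.
Proof.
move=> e; have : x \in [set y; v]%SET by rewrite -e !inE eqxx.
rewrite !inE => /orP[/eqP//|/eqP xv].
have : y \in [set x; v]%SET by rewrite e !inE eqxx.
by rewrite !inE xv orbb => /eqP ->.
Qed.

Lemma mem_edges G u v : ([set u; v]%SET \in edges G) = adj G u v.
Proof.
rewrite inE; apply/existsP/idP => [[x /existsP[y /andP[xy /eqP e]]]|uv].
  have : x \in [set u; v]%SET by rewrite e !inE eqxx.
  rewrite !inE => /orP[]/eqP xe; subst x.
    by rewrite finset.setUC [RHS]finset.setUC in e; rewrite (set2_eq_r e).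
  by rewrite [RHS]finset.setUC in e; rewrite (set2_eq_r e) adj_sym.
by exists u; apply/existsP; exists v; rewrite uv eqxx.
Qed.

Lemma edgesP G (e : {set V}) :
  reflect (exists u v, adj G u v /\ e = [set u; v]%SET) (e \in edges G).
Proof.
rewrite inE; apply: (iffP existsP) => [[u /existsP[v /andP[uv /eqP ->]]]|].
  by exists u, v.
by move=> [u [v [uv ->]]]; exists u; apply/existsP; exists v; rewrite uv eqxx.
Qed.

Lemma card_edge G (e : {set V}) : e \in edges G -> #|e| = 2%N.
Proof.
move=> /edgesP[u [v [uv ->]]]; rewrite cards2.
by case: eqP uv => // ->; rewrite adj_irrefl.
Qed.

Lemma card_incident G v : #|[set e in edges G | v \in e]%SET| = #|nbhd G v|.
Proof.
rewrite -[RHS](@card_imset _ _ (fun u => [set u; v]%SET)); last first.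
  by move=> x y; exact: set2_eq_r.
apply: eq_card => e; rewrite inE.
apply/andP/imsetP => [[/edgesP[x [y [xy ->]]]]|[u]].
  rewrite !inE => /orP[]/eqP ->; first by exists y; rewrite ?inE // finset.setUC.
  by exists x; rewrite // inE adj_sym.
by rewrite inE adj_sym -mem_edges => uv ->; rewrite uv !inE eqxx orbT.
Qed.

Lemma double_count (S : {set V}) X :
  (\sum_(v in S) #|[set e in X | v \in e]%SET| = \sum_(e in X) #|S :&: e|)%N.
Proof.
under eq_bigr do rewrite cardsE -sum1_card big_mkcondr /=.
rewrite exchange_big /=; apply: eq_bigr => e _.
rewrite -sum1_card -big_mkcondr /=.
by apply: eq_bigl => v; rewrite !inE.
Qed.

(** Let [S] hold the nodes of degree at least [b] in [F]. At such a node [M] has no more edges than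
    [F]; cancelling the common edges compares [M :\: edges F] with [edges F :\: M]. Each edge of the
    former meets [S], and each edge of the latter meets it at most twice. *)
Lemma opt_le_double G F b :
  (forall u v, adj G u v ->
    [|| adj F u v, b <= #|nbhd F u| | b <= #|nbhd F v|]%N) ->
  (opt G b <= 2 * #|edges F|)%N.
Proof.
move=> maxF; apply/bigmax_leqP => M /andP[/fintype.subsetP MG /forallP Mb].
pose S := [set v | (b <= #|nbhd F v|)%N]%SET.
have deg_split X Y v : #|[set e in X | v \in e]%SET| =
    (#|[set e in X :&: Y | v \in e]%SET| + #|[set e in X :\: Y | v \in e]%SET|)%N.
  rewrite -(cardsID Y [set e in X | v \in e]%SET); congr (_ + _)%N;
    by apply: eq_card => e; rewrite !inE; do 3?case: (_ \in _).
have le1 : (#|M :\: edges F| <= 2 * #|edges F :\: M|)%N.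
  apply: (@leq_trans (\sum_(e in M :\: edges F) #|S :&: e|)%N).
    rewrite -sum1_card; apply: leq_sum => e; rewrite inE => /andP[eF eM].
    have /edgesP[u [v [uv eE]]] := MG _ eM; rewrite eE mem_edges in eF.
    move: (maxF u v uv); rewrite (negPf eF) /= card_gt0 eE => /orP[] h;
      apply/finset.set0Pn; [exists u|exists v]; by rewrite !inE h eqxx ?orbT.
  rewrite -double_count.
  apply: (@leq_trans (\sum_(v in S) #|[set e in edges F :\: M | v \in e]%SET|)%N).
    apply: leq_sum => v; rewrite inE => vS.
    move: (Mb v) vS; rewrite -card_incident (deg_split M (edges F)).
    by rewrite (deg_split (edges F) M) (finset.setIC (edges F)); lia.
  rewrite double_count -sum1_card big_distrr /=; apply: leq_sum => e.
  rewrite inE => /andP[_ eF]; rewrite muln1 -(card_edge eF).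
  by apply: subset_leq_card; rewrite subsetIr.
rewrite -(cardsID (edges F) M) -(cardsID M (edges F)) (finset.setIC (edges F)).
by move: le1; lia.
Qed.

(** Here [e] is the pair in which the graphs differ: only its two endpoints see a different
    adjacency list, so only they cost privacy. *)
Lemma edge_neighboring_nbhd G G' : edge_neighboring G G' ->
  exists e : {set V}, (#|e| <= 2)%N /\
  forall v, if v \in e then (#|nbhd G v :\: nbhd G' v| <= 1)%N /\
                            (#|nbhd G' v :\: nbhd G v| <= 1)%N
            else nbhd G v = nbhd G' v.
Proof.
move=> /eqP/cards1P[e eE].
have ein : e \in edges G \/ e \in edges G'.
  have : e \in [set e]%SET by rewrite inE.
  by rewrite -eE !inE => /orP[]/andP[_]; [left|right].
have xorP u v : (adj G u v != adj G' u v) = ([set u; v]%SET == e).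
  transitivity ([set u; v]%SET \in [set e]%SET); last by rewrite finset.in_set1.
  rewrite -!mem_edges -eE finset.in_setU !finset.in_setD.
  by do 2!case: (_ \in _).
exists e; split; first by case: ein => /card_edge ->.
move=> v; case: ifP => ve.
  by split; apply/card_le1_eqP => x y; rewrite !inE => /andP[x1 x2] /andP[y1 y2];
    apply: (@set2_eq_r _ _ v); transitivity e;
    apply/eqP; rewrite 1?[e == _]eq_sym -xorP adj_sym [X in _ != X]adj_sym;
    rewrite ?x2 ?y2 ?(negPf x1) ?(negPf y1).
apply/setP => u; rewrite !inE; apply/eqP; apply: contraFT ve.
by rewrite xorP => /eqP <-; rewrite !inE eqxx.
Qed.

End Graphs.

(** * Discrete masses as finite sums, and biased coins *)

Section Mass.
Variable R : realType.

(** Meant for transcripts: their type is infinite, but only those of length [T] can have positive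
    mass. *)
Lemma mass_finite (I : finType) (X : choiceType) (f : I -> X) (p : X -> R)
    (A : set X) : injective f -> (forall x, 0 <= p x) ->
    (forall x, ~ range f x -> p x = 0) ->
  mass p A = (\sum_(i : I) p (f i) * (f i \in A)%:R)%:E.
Proof.
move=> injf p0 supp; rewrite /mass esum_mkcond.
transitivity (\esum_(x in range f) (if x \in A then (p x)%:E else 0%E)).
  rewrite [RHS]esum_mkcond; apply: eq_esum => x _.
  case: ifPn => xA; case: ifPn => //; rewrite notin_setE => xf.
  by rewrite supp.
rewrite esum_image; last by move=> x y _ _; exact: injf.
rewrite esum_fset; [|exact: finite_finset|by move=> i _; case: ifP => _ //; rewrite lee_fin].
rewrite (_ : setT = [set` index_enum I]); last first.
  by apply/seteqP; split=> i _ //=; rewrite mem_index_enum.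
rewrite -fsbig_seq ?index_enum_uniq //.
rewrite -sumEFin; apply: eq_bigr => i _.
by case: ifP => _; rewrite ?mulr1 ?mulr0.
Qed.

Lemma big_tuple_cons (M : finType) k (F : seq M -> R) :
  \sum_(t : k.+1.-tuple M) F t = \sum_(m : M) \sum_(t : k.-tuple M) F (m :: t).
Proof.
rewrite pair_big /= (reindex (fun x : M * k.-tuple M => cons_tuple x.1 x.2)) //=.
exists (fun t => (thead t, [tuple of behead t])) => [[m t] _|t _] /=.
  by rewrite theadE; congr (_, _); apply: val_inj.
by rewrite [RHS]tuple_eta; apply: val_inj.
Qed.

Section Coin.
Variables (p : R) (p01 : 0 <= p <= 1).

Definition coin_mass (b : bool) : R := if b then p else 1 - p.

Lemma coin_mass_ge0 b : 0 <= coin_mass b.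
Proof. by case/andP: p01; case: b => /=; lra. Qed.

Lemma mass_bool (q : bool -> R) (A : set bool) : (forall b, 0 <= q b) ->
  mass q A = (q true * (true \in A)%:R + q false * (false \in A)%:R)%:E.
Proof.
by move=> q0; rewrite (@mass_finite bool _ id) ?big_bool // => x [].
Qed.

Lemma coin_mass1 : mass coin_mass setT = 1%E.
Proof.
rewrite mass_bool; last exact: coin_mass_ge0.
by rewrite !in_setT !mulr1 /=; congr (_%:E); lra.
Qed.

Definition coin : dist R bool := Dist coin_mass_ge0 coin_mass1.

End Coin.
End Mass.

Lemma quotient_le (R : realType) (E a a' b b' : R) :
  0 <= E -> 0 <= a' -> 0 < b -> 0 < b' -> a <= E * a' -> b' <= E * b ->
  a / b <= E ^+ 2 * (a' / b').
Proof.
move=> E0 a'0 b0 b'0 aa' bb'; rewrite ler_pdivrMr // (le_trans aa') //.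
rewrite (_ : E ^+ 2 * _ * b = E * a' * (E * b / b')); last by ring.
by rewrite ler_peMr ?mulr_ge0 // ler_pdivlMr // mul1r.
Qed.

Definition almost_subset (I : finType) (A B : {set I}) := (#|A :\: B| <= 1)%N.

Lemma differ_in_one_almost (I : finType) (A B : {set I}) :
  differ_in_one A B -> almost_subset A B /\ almost_subset B A.
Proof.
rewrite /differ_in_one /almost_subset => AB.
by split; (apply: leq_trans (eq_leq AB); apply: subset_leq_card);
  rewrite ?finset.subsetUl ?finset.subsetUr.
Qed.

(** * The stopping test and its local privacy *)

Section Protocol.
Variables (R : realType) (n T : nat) (e0 K : R).
Hypotheses (e0_ge0 : 0 <= e0) (K_gt0 : 0 < K).

Local Notation round := {ffun 'I_n -> option bool}.
Local Notation history := (seq round).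
Implicit Types (h s p : history) (m : round) (v : 'I_n) (N : {set 'I_n}).

(* In every round a node that has always answered [Some true] runs a test, and
   the answer [Some false] makes it stop for good. *)
Definition alive h v : bool := all (fun m : round => m v == Some true) h.

(* The pair {u, v} is processed in round u + v, so that the pairs containing a
   given node are processed in distinct rounds. *)
Definition kept p (u v : 'I_n) : bool :=
  alive (take (u + v) p) u && alive (take (u + v) p) v.

(** The bound on [u + v] retains the pairs whose fate [h] already decides. Those of the coming round
    [size h] are included, since they depend on earlier answers only. *)
Definition kept_nbhd N h v : {set 'I_n} :=
  [set u in N | (u + v <= size h)%N && kept h u v]%SET.

Definition weight N h v : R := expR (e0 * #|kept_nbhd N h v|%:R).

Definition potential N h v : R :=
  K + \sum_(i < size h) weight N (take i h) v.

Definition survival N h v : R :=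
  potential N h v / (potential N h v + weight N h v).

Lemma expR_e0_ge1 : 1 <= expR e0.
Proof. by rewrite -expR0 ler_expR. Qed.

Lemma weight_gt0 N h v : 0 < weight N h v.
Proof. exact: expR_gt0. Qed.

Lemma potential_geK N h v : K <= potential N h v.
Proof. by rewrite lerDl sumr_ge0 // => i _; exact/ltW/weight_gt0. Qed.

Lemma potential_gt0 N h v : 0 < potential N h v.
Proof. exact: lt_le_trans K_gt0 (potential_geK _ _ _). Qed.

Lemma potential_nil N v : potential N [::] v = K.
Proof. by rewrite /potential big_ord0 addr0. Qed.

Lemma potential_rcons N h m v :
  potential N (rcons h m) v = potential N h v + weight N h v.
Proof.
rewrite /potential size_rcons big_ord_recr /= -cats1 take_size_cat // addrA.
by congr (_ + _ + _); apply: eq_bigr => i _; rewrite takel_cat // ltnW.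
Qed.

Lemma potential_weight_gt0 N h v : 0 < potential N h v + weight N h v.
Proof. by rewrite addr_gt0 ?potential_gt0 ?weight_gt0. Qed.

Lemma survival01 N h v : 0 <= survival N h v <= 1.
Proof.
apply/andP; split.
  by rewrite divr_ge0 ?(ltW (potential_gt0 _ _ _)) ?(ltW (potential_weight_gt0 _ _ _)).
rewrite ler_pdivrMr ?potential_weight_gt0 // mul1r lerDl.
exact/ltW/weight_gt0.
Qed.

Lemma stopE N h v :
  1 - survival N h v = weight N h v / (potential N h v + weight N h v).
Proof.
have := potential_weight_gt0 N h v; rewrite /survival => /lt0r_neq0 ?; field.
by [].
Qed.

Lemma weight_almost N N' h v : almost_subset N N' ->
  weight N h v <= expR e0 * weight N' h v.
Proof.
move=> NN'; rewrite -expRD ler_expR -[X in X + _]mulr1 -mulrDr ler_wpM2l //.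
rewrite addrC natr1 ler_nat -add1n.
apply: leq_trans (leq_add NN' (leqnn _)).
apply: leq_trans (leq_card_setU _ _).1; apply: subset_leq_card.
by apply/fintype.subsetP => u; rewrite !inE; do 2!case: (_ \in _).
Qed.

Lemma potential_almost N N' h v : almost_subset N N' ->
  potential N h v <= expR e0 * potential N' h v.
Proof.
move=> NN'; rewrite mulrDr mulr_sumr lerD //.
  by rewrite ler_peMl ?(ltW K_gt0) ?expR_e0_ge1.
by apply: ler_sum => i _; exact: weight_almost.
Qed.

(** The probabilities of both answers are quotients whose numerator and denominator each change by a
    factor at most [expR e0]. This concerns a single test; composing it over all rounds would cost a
    factor [T], so the whole transcript is treated separately. *)
Lemma stop_test_dp h v N N' : differ_in_one N N' ->
  dp_close (e0 * 2%:R) (coin (survival01 N h v))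
                       (coin (survival01 N' h v)).
Proof.
move=> /differ_in_one_almost[NN' N'N] A.
rewrite !mass_bool; try by move=> b; exact: coin_mass_ge0 (survival01 _ _ _) _.
rewrite -EFinM lee_fin mulrDr expRM_natr !mulrA.
have pw N1 N2 : almost_subset N1 N2 ->
    potential N1 h v + weight N1 h v <=
      expR e0 * (potential N2 h v + weight N2 h v).
  by move=> ?; rewrite mulrDr lerD ?weight_almost ?potential_almost.
by apply: lerD; apply: ler_wpM2r => //=;
  rewrite /coin_mass ?stopE /survival; rewrite -?[_ ^+ 2 * _ / _]mulrA;
  apply: quotient_le; rewrite ?pw ?weight_almost ?potential_almost ?expR_ge0
    ?potential_weight_gt0 ?(ltW (weight_gt0 _ _ _)) ?(ltW (potential_gt0 _ _ _)).
Qed.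

Lemma test_eps_ge0 : 0 <= e0 * 2%:R.
Proof. exact: mulr_ge0. Qed.

Definition stop_test h v : local_randomizer R 'I_n bool :=
  LocalRandomizer test_eps_ge0 (@stop_test_dp h v).

Definition stopping_strategy : strategy R 'I_n bool := fun h =>
  if (size h < T)%N then
    Some (fun v => if alive h v then Some (stop_test h v) else None)
  else None.

(** * Factorization of the transcript probability over the nodes *)

Definition node_step N v h (x : option bool) : R :=
  if alive h v then
    if x is Some b then coin_mass (survival N h v) b else 0
  else (x == None)%:R.

Fixpoint node_pmf N v h s : R :=
  if s is m :: s' then node_step N v h (m v) * node_pmf N v (rcons h m) s'
  else 1.

Lemma node_step_ge0 N v h x : 0 <= node_step N v h x.
Proof.
rewrite /node_step; case: ifP => _ //; case: x => // b.
exact: coin_mass_ge0 (survival01 _ _ _) _.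
Qed.

Lemma node_step_sum1 N v h : \sum_x node_step N v h x = 1.
Proof.
rewrite (bigD1 None) //= (bigD1 (Some true)) //= (bigD1 (Some false)) //=.
rewrite big1 ?addr0 => [|[[]|] //].
by rewrite /node_step; case: ifP => _ /=; ring.
Qed.

Lemma node_pmf_ge0 N v h s : 0 <= node_pmf N v h s.
Proof.
by elim: s h => //= m s IH h; rewrite mulr_ge0 ?node_step_ge0.
Qed.

Lemma round_pmfE G h m : (size h < T)%N ->
  round_pmf stopping_strategy G h m = \prod_v node_step (nbhd G v) v h (m v).
Proof.
move=> hT; rewrite /round_pmf /stopping_strategy hT; apply: eq_bigr => v _.
by rewrite /node_step; case: ifP => _; case: (m v).
Qed.

(** Given the history, the nodes answer independently, and each factor depends on [G] only through
    one adjacency list. The indicator records that the run halts after exactly [T] rounds. *)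
Lemma run_pmfE G h s : (size h <= T)%N ->
  run_pmf stopping_strategy G h s =
  (size h + size s == T)%N%:R * \prod_v node_pmf (nbhd G v) v h s.
Proof.
elim: s h => [|m s IH] h hT /=.
  rewrite /stopping_strategy addn0 big1 // mulr1.
  by case: ltngtP hT.
move: hT; rewrite leq_eqVlt => /orP[/eqP hT|hT].
  rewrite /round_pmf /stopping_strategy hT ltnn mul0r.
  by rewrite -[X in _ == X]addn0 eqn_add2l mul0r.
rewrite round_pmfE // IH ?size_rcons // addSnnS.
by rewrite mulrCA -big_split.
Qed.

(** * Privacy of the whole transcript *)

Lemma alive_rcons h m v : alive (rcons h m) v = (m v == Some true) && alive h v.
Proof. by rewrite /alive all_rcons. Qed.

Lemma node_pmf_stopped N N' v h s : ~~ alive h v ->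
  node_pmf N v h s = node_pmf N' v h s.
Proof.
elim: s h => //= m s IH h hv; rewrite (IH (rcons h m)).
  by rewrite /node_step (negPf hv).
by rewrite alive_rcons (negPf hv) andbF.
Qed.

(* A survival multiplies [node_pmf] by the ratio of two consecutive potentials,
   so the quotient below telescopes and only the end of the run costs privacy. *)
Lemma node_pmf_div_potential N N' v h s :
  almost_subset N N' -> almost_subset N' N -> alive h v ->
  node_pmf N v h s / potential N h v <=
  expR e0 ^+ 3 * (node_pmf N' v h s / potential N' h v).
Proof.
move=> NN' N'N; set E := expR e0.
have E1 : 1 <= E by exact: expR_e0_ge1.
have E0 : 0 <= E by apply: le_trans E1.
elim: s h => [|m s IH] h hv /=.
  apply: (@le_trans _ _ (E ^+ 2 * (1 / potential N' h v))).
    by apply: quotient_le; rewrite ?potential_gt0 ?potential_almost // mulr1.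
  rewrite ler_wpM2r ?divr_ge0 ?(ltW (potential_gt0 _ _ _)) //.
  by rewrite [X in _ <= X]exprS ler_peMl ?exprn_ge0.
rewrite /node_step hv; case E_m: (m v) => [[]|] /=; last by rewrite !mul0r mulr0.
  (* Survival: [P / (P + w) / P] is the inverse of the next potential, so the induction hypothesis
     applies at no cost. *)
  have hv' : alive (rcons h m) v by rewrite alive_rcons E_m hv.
  have {IH} := IH _ hv'; rewrite !potential_rcons /survival.
  set P := potential _ _ _; set P' := potential _ _ _.
  set w := weight _ _ _; set w' := weight _ _ _.
  have P0 : P != 0 by rewrite lt0r_neq0 ?potential_gt0.
  have P'0 : P' != 0 by rewrite lt0r_neq0 ?potential_gt0.
  rewrite (_ : P / (P + w) * _ / P = node_pmf N v (rcons h m) s / (P + w)).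
    rewrite (_ : P' / (P' + w') * _ / P' =
      node_pmf N' v (rcons h m) s / (P' + w')) //.
    by rewrite mulrAC [P' / _ / _]mulrAC divff // mul1r mulrC.
  by rewrite mulrAC [P / _ / _]mulrAC divff // mul1r mulrC.
(* Stop: the later answers no longer depend on the list. The stopping probability costs [E ^+ 2] and
   the inverse potential costs [E]. *)
rewrite !stopE (@node_pmf_stopped N N'); last by rewrite alive_rcons E_m.
set X := node_pmf _ _ _ _.
have q : weight N h v / (potential N h v + weight N h v) <=
    E ^+ 2 * (weight N' h v / (potential N' h v + weight N' h v)).
  apply: quotient_le; rewrite ?potential_weight_gt0 ?weight_almost //.
    exact/ltW/weight_gt0.
  by rewrite mulrDr lerD ?weight_almost ?potential_almost.
have r : (potential N h v)^-1 <= E * (potential N' h v)^-1.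
  rewrite -[X in X <= _]mul1r ler_pdivrMr ?potential_gt0 // mulrAC.
  by rewrite ler_pdivlMr ?potential_gt0 // mul1r potential_almost.
rewrite mulrAC [X in _ <= X](_ : _ = E ^+ 2 *
  (weight N' h v / (potential N' h v + weight N' h v)) *
  (E * (potential N' h v)^-1) * X); last by ring.
rewrite ler_wpM2r ?node_pmf_ge0 // ler_pM ?invr_ge0 ?(ltW (potential_gt0 _ _ _)) //.
by rewrite divr_ge0 ?(ltW (weight_gt0 _ _ _)) ?(ltW (potential_weight_gt0 _ _ _)).
Qed.

(** At the empty history both potentials equal [K] and cancel. *)
Lemma node_pmf_dp N N' v s : almost_subset N N' -> almost_subset N' N ->
  node_pmf N v [::] s <= expR e0 ^+ 3 * node_pmf N' v [::] s.
Proof.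
move=> NN' N'N; have := @node_pmf_div_potential _ _ v [::] s NN' N'N isT.
by rewrite !potential_nil mulrA ler_pM2r // invr_gt0.
Qed.

Lemma transcript_pmf_neighbor G G' s : edge_neighboring G G' ->
  transcript_pmf stopping_strategy G s <=
  expR (e0 * 6%:R) * transcript_pmf stopping_strategy G' s.
Proof.
move=> /edge_neighboring_nbhd[e [e2 He]].
rewrite /transcript_pmf !run_pmfE // mulrCA ler_wpM2l //.
have E1 : 1 <= expR e0 ^+ 3 by rewrite exprn_ege1 ?expR_e0_ge1.
apply: (@le_trans _ _ (\prod_(v : 'I_n)
    ((if v \in e then expR e0 ^+ 3 else 1) * node_pmf (nbhd G' v) v [::] s))).
  apply: ler_prod => v _; rewrite node_pmf_ge0 /=.
  by move: (He v); case: ifP => _ => [[]|->]; [exact: node_pmf_dp|rewrite mul1r].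
rewrite big_split ler_wpM2r ?prodr_ge0 //= => [v _|]; first exact: node_pmf_ge0.
rewrite -big_mkcond prodr_const -exprM expRM_natr ler_weXn2l ?expR_e0_ge1 //.
by rewrite (leq_mul2l 3 _ 2).
Qed.

(** * Probabilities of events along a run *)

Lemma run_pmf_ge0 G h s : (size h <= T)%N ->
  0 <= run_pmf stopping_strategy G h s.
Proof.
by move=> hT; rewrite run_pmfE // mulr_ge0 ?prodr_ge0 // => v _; exact: node_pmf_ge0.
Qed.

(** Using [node_pmf] instead of [run_pmf] avoids the halting condition, so the number [k] of
    remaining rounds is free for induction. *)
Definition run_prob G k h (E : pred history) : R :=
  \sum_(s : k.-tuple round) (\prod_v node_pmf (nbhd G v) v h s) * (E s)%:R.

Lemma mass_transcript G (A : set history) :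
  mass (transcript_pmf stopping_strategy G) A =
  (run_prob G T [::] (fun s => s \in A))%:E.
Proof.
rewrite (@mass_finite _ (T.-tuple round) _ val).
- congr (_%:E); apply: eq_bigr => s _; congr (_ * _).
  by rewrite /transcript_pmf run_pmfE //= size_tuple eqxx mul1r.
- exact: val_inj.
- by move=> s; exact: run_pmf_ge0.
- move=> s sT; rewrite /transcript_pmf run_pmfE //=.
  case: eqP => [sz|]; last by rewrite mul0r.
  by exfalso; apply: sT; exists (Tuple (introT eqP sz)).
Qed.

Lemma run_prob_le G k h (E E' : pred history) :
  (forall s, size s = k -> E s -> E' s) -> run_prob G k h E <= run_prob G k h E'.
Proof.
move=> EE'; apply: ler_sum => s _; apply: ler_wpM2l.
  by apply: prodr_ge0 => v _; exact: node_pmf_ge0.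
rewrite ler_nat; case: (boolP (E s)) => // /EE' -> //; exact: size_tuple.
Qed.

Lemma run_prob_cons G k h (E : pred history) :
  run_prob G k.+1 h E =
  \sum_(m : round) (\prod_v node_step (nbhd G v) v h (m v)) *
         run_prob G k (rcons h m) (fun s => E (m :: s)).
Proof.
rewrite /run_prob (big_tuple_cons _ (fun s : history =>
  (\prod_v node_pmf (nbhd G v) v h s) * (E s)%:R)); apply: eq_bigr => m _.
by rewrite mulr_sumr; apply: eq_bigr => s _; rewrite big_split /= mulrA.
Qed.

Lemma round_marginal G h v (g : option bool -> R) :
  \sum_(m : round) (\prod_u node_step (nbhd G u) u h (m u)) * g (m v) =
  \sum_x node_step (nbhd G v) v h x * g x.
Proof.
transitivity (\sum_(m : round)
    \prod_u (node_step (nbhd G u) u h (m u) * (if u == v then g (m u) else 1))).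
  apply: eq_bigr => m _; rewrite big_split -big_mkcond /=.
  by rewrite big_pred1_eq.
rewrite -(bigA_distr_bigA (fun u x =>
  node_step (nbhd G u) u h x * (if u == v then g x else 1))).
rewrite (bigD1 v) //= [X in _ * X]big1 ?mulr1.
  by apply: eq_bigr => x _; rewrite eqxx.
move=> u /negPf uv; under eq_bigr do rewrite uv mulr1; exact: node_step_sum1.
Qed.

Lemma round_total G h :
  \sum_(m : round) \prod_u node_step (nbhd G u) u h (m u) = 1.
Proof.
rewrite -(bigA_distr_bigA (fun u x => node_step (nbhd G u) u h x)).
by rewrite big1 // => u _; exact: node_step_sum1.
Qed.

Lemma run_probT G k h : run_prob G k h xpredT = 1.
Proof.
elim: k h => [|k IH] h.
  rewrite /run_prob (bigD1 [tuple]) //= [X in _ + X]big1 ?addr0 => [|s].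
    by rewrite big1 ?mulr1.
  by rewrite (tuple0 s).
rewrite run_prob_cons -[RHS](round_total G h); apply: eq_bigr => m _.
by rewrite (IH (rcons h m)) mulr1.
Qed.

Lemma run_probC G k h (E : pred history) :
  run_prob G k h E = 1 - run_prob G k h (predC E).
Proof.
rewrite -(run_probT G k h) /run_prob -sumrB; apply: eq_bigr => s _ /=.
by case: (E s) => /=; ring.
Qed.

Lemma run_prob_union G k h (I : finType) (E : I -> pred history) :
  run_prob G k h (fun s => [exists i, E i s]) <= \sum_i run_prob G k h (E i).
Proof.
rewrite /run_prob exchange_big /=; apply: ler_sum => s _.
rewrite -mulr_sumr ler_wpM2l //.
  by apply: prodr_ge0 => v _; exact: node_pmf_ge0.
case: existsP => [[i Ei]|_]; last by rewrite sumr_ge0.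
by rewrite (bigD1 i) //= Ei lerDl sumr_ge0.
Qed.

Fixpoint occurs (B : history -> round -> bool) h s : bool :=
  if s is m :: s' then B h m || occurs B (rcons h m) s' else false.

Lemma occurs_nth (B : history -> round -> bool) h s i (m0 : round) : (i < size s)%N ->
  B (h ++ take i s) (nth m0 s i) -> occurs B h s.
Proof.
elim: s h i => //= m s IH h [|i]; first by rewrite cats0 => _ ->.
by rewrite ltnS -cat_rcons => si /(IH _ _ si) ->; rewrite orbT.
Qed.

(* Doob's maximal inequality: [phi] is a supermartingale until [B] occurs, and
   is worth at least 1 then. *)
Lemma run_prob_occurs G (B : history -> round -> bool) (phi : history -> R) k h :
  (forall h, 0 <= phi h) ->
  (forall h, (size h < T)%N ->
    \sum_(m : round) (\prod_v node_step (nbhd G v) v h (m v)) *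
      (if B h m then 1 else phi (rcons h m)) <= phi h) ->
  (size h + k <= T)%N -> run_prob G k h (occurs B h) <= phi h.
Proof.
move=> phi0 step; elim: k h => [|k IH] h hk.
  rewrite /run_prob big1 // => s _.
  by rewrite (tuple0 s) /= mulr0.
rewrite run_prob_cons (le_trans _ (step h _)) //; last first.
  by apply: leq_trans hk; rewrite addnS ltnS leq_addr.
apply: ler_sum => m _; apply: ler_wpM2l.
  by apply: prodr_ge0 => v _; exact: node_step_ge0.
case: ifP => Bm /=.
  by rewrite -(run_probT G k (rcons h m)); apply: run_prob_le.
by rewrite Bm; apply: IH; rewrite size_rcons addSnnS.
Qed.

(** * The two bad events of a node *)

Definition early_stop G (d : nat) v h m : bool :=
  [&& alive h v, m v != Some true & (#|kept_nbhd (nbhd G v) h v| < d)%N].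

Definition late_survival G (d : nat) v h m : bool :=
  [&& alive h v, m v == Some true & (d <= #|kept_nbhd (nbhd G v) h v|)%N].

(** A union bound over rounds: a test taken with fewer than [d] kept neighbors fails with
    probability at most [delta], so [delta] times the number of remaining rounds is a
    supermartingale. *)
Lemma run_prob_early G d v :
  run_prob G T [::] (occurs (early_stop G d v) [::]) <=
  T%:R * (expR (e0 * d%:R) / K).
Proof.
set delta := _ / K.
have delta0 : 0 <= delta by rewrite divr_ge0 ?expR_ge0 ?ltW.
rewrite -[X in X%:R]subn0.
apply: (@run_prob_occurs G _ (fun h => (T - size h)%:R * delta)) => //.
  by move=> h; rewrite mulr_ge0.
move=> h hT; rewrite -(subnSK hT) -natr1 mulrDl mul1r.
set c := _ * delta; have c0 : 0 <= c by rewrite mulr_ge0.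
pose g x : R := if [&& alive h v, x != Some true
  & (#|kept_nbhd (nbhd G v) h v| < d)%N] then 1 else c.
rewrite [leLHS](_ : _ = \sum_(m : round)
    (\prod_u node_step (nbhd G u) u h (m u)) * g (m v)); last first.
  by apply: eq_bigr => m _; rewrite size_rcons.
rewrite round_marginal /g.
case: (boolP (alive h v && (#|kept_nbhd (nbhd G v) h v| < d)%N)) => [/andP[hv hd]|].
  have stop_le : 1 - survival (nbhd G v) h v <= delta.
    rewrite stopE ler_pM ?invr_ge0 ?expR_ge0 ?(ltW (potential_weight_gt0 _ _ _)) //.
      by rewrite /weight ler_expR ler_wpM2l // ler_nat ltnW.
    rewrite lef_pV2 ?posrE ?potential_weight_gt0 //.
    by rewrite (le_trans (potential_geK (nbhd G v) h v)) // lerDl ltW ?weight_gt0.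
  have := survival01 (nbhd G v) h v => /andP[s0 s1].
  rewrite (bigD1 None) //= (bigD1 (Some true)) //= (bigD1 (Some false)) //=.
  rewrite big1 ?addr0 => [|[[]|] //].
  rewrite /node_step hv hd /= mul0r add0r mulr1 lerD //.
  by rewrite ler_piMl.
move=> nh; rewrite (eq_bigr (fun x => node_step (nbhd G v) v h x * c)).
  by rewrite -mulr_suml node_step_sum1 mul1r lerDl.
by move=> x _; rewrite andbCA (negPf nh) andbF.
Qed.

(** The supermartingale is the potential of a running node, scaled by [ex], and 0 once it stops.
    With potential [P] and weight [w], where [w] is at least [expR (e0 * d%:R)], survival has
    probability [P / (P + w)], at most [P * ex], which pays for the value 1. *)
Lemma run_prob_late G d v :
  run_prob G T [::] (occurs (late_survival G d v) [::]) <=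
  K * expR (- (e0 * d%:R)).
Proof.
set ex := expR _; have ex0 : 0 <= ex by exact: expR_ge0.
pose phi h : R := if alive h v then potential (nbhd G v) h v * ex else 0.
rewrite [leRHS](_ : _ = phi [::]); last by rewrite /phi /= potential_nil.
apply: (@run_prob_occurs G) => //.
  move=> h; rewrite /phi; case: ifP => // _.
  by rewrite mulr_ge0 // ltW ?potential_gt0.
move=> h hT.
pose g x : R := if [&& alive h v, x == Some true
  & (d <= #|kept_nbhd (nbhd G v) h v|)%N] then 1 else
  if (x == Some true) && alive h v then
    (potential (nbhd G v) h v + weight (nbhd G v) h v) * ex else 0.
rewrite [leLHS](_ : _ = \sum_(m : round)
    (\prod_u node_step (nbhd G u) u h (m u)) * g (m v)); last first.
  by apply: eq_bigr => m _; rewrite /g /late_survival /phi alive_rcons potential_rcons.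
rewrite round_marginal (bigD1 None) //= (bigD1 (Some true)) //=.
rewrite (bigD1 (Some false)) //= big1 ?addr0 => [|[[]|] //].
rewrite /g /node_step /phi /= ?andbF !mulr0 add0r addr0.
case: (boolP (alive h v)) => hv /=; last by rewrite mul0r.
rewrite /survival; case: ifP => [hd|_]; last first.
  by rewrite mulrA divfK ?lt0r_neq0 ?potential_weight_gt0.
rewrite mulr1 ler_wpM2l ?(ltW (potential_gt0 _ _ _)) // /ex expRN.
rewrite lef_pV2 ?posrE ?potential_weight_gt0 ?expR_gt0 //.
rewrite (@le_trans _ _ (weight (nbhd G v) h v)) //.
  by rewrite /weight ler_expR ler_wpM2l // ler_nat.
by rewrite lerDr ltW ?potential_gt0.
Qed.

(** * Size and degrees of the decoded solution when no bad event occurs *)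

Definition pair_solution p : implicit_solution 'I_n :=
  fun v => [set u | kept p u v]%SET.

Lemma kept_sym p u v : kept p u v = kept p v u.
Proof. by rewrite /kept addnC andbC. Qed.

Lemma kept_take p i (u v : 'I_n) : (u + v <= i)%N -> kept (take i p) u v = kept p u v.
Proof. by move=> uvi; rewrite /kept take_takel. Qed.

Lemma nbhd_pair_solution G p v :
  nbhd (implicit_graph G (pair_solution p)) v =
  [set u in nbhd G v | kept p u v]%SET.
Proof.
apply/setP => u; rewrite !inE /= /implicit_adj !inE.
by rewrite (kept_sym p v u) orbb.
Qed.

Lemma alive_takeS p i v : (i < size p)%N ->
  alive (take i.+1 p) v = (nth [ffun=> None] p i v == Some true) && alive (take i p) v.
Proof. by move=> ip; rewrite (take_nth [ffun=> None]) // alive_rcons. Qed.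

Lemma stopped_before p v j : ~~ alive (take j p) v ->
  exists i, [/\ (i < j)%N, (i < size p)%N, alive (take i p) v
              & nth [ffun=> None] p i v != Some true].
Proof.
elim: j => [|j IH]; first by rewrite take0.
case: (ltnP j (size p)) => jp.
  rewrite alive_takeS // negb_and; case: (boolP (alive (take j p) v)) => /= [jv|/IH].
    by rewrite orbF => ?; exists j.
  by move=> [i [ij ip iv ni]] _; exists i; rewrite ltnS ltnW.
rewrite (_ : take j.+1 p = take j p); last by rewrite !take_oversize ?leqW.
move=> /IH[i [ij ip iv ni]].
by exists i; rewrite ltnS ltnW.
Qed.

Lemma kept_nbhd_take G p i v :
  (#|kept_nbhd (nbhd G v) (take i p) v| <=
   #|nbhd (implicit_graph G (pair_solution p)) v|)%N.
Proof.
rewrite nbhd_pair_solution; apply: subset_leq_card.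
apply/fintype.subsetP => u; rewrite !inE => /and3P[-> ui /=].
by rewrite kept_take // (leq_trans ui) // size_take_min geq_minl.
Qed.

(** An edge that is not kept has an endpoint that stopped earlier. That stop was not early, so this
    endpoint already had [d] kept neighbors, which it retains. *)
Lemma pair_solution_size G p d :
  (forall v, ~~ occurs (early_stop G d v) [::] p) ->
  (opt G d <= 2 * implicit_size G (pair_solution p))%N.
Proof.
move=> no_early; apply: opt_le_double => x y xy.
have deg v j : ~~ alive (take j p) v ->
    (d <= #|nbhd (implicit_graph G (pair_solution p)) v|)%N.
  move=> /stopped_before[i [_ ip iv ni]].
  have := contra (@occurs_nth _ [::] p i [ffun=> None] ip) (no_early v).
  rewrite /early_stop iv ni /= -leqNgt => /leq_trans; apply.
  exact: kept_nbhd_take.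
have -> : adj (implicit_graph G (pair_solution p)) x y = kept p x y.
  by rewrite /= /implicit_adj xy !inE (kept_sym p y x) orbb.
rewrite {1}/kept.
case: (boolP (alive _ x)) => [_|/deg ->]; last by rewrite !orbT.
by case: (boolP (alive _ y)) => [_|/deg ->]; rewrite ?orbT.
Qed.

(** If [v] had more than [d] kept neighbors, let [u] be the largest. Keeping the pair of [u] and [v]
    requires [v] to survive round [u + v - 1], whose test already counts all the other neighbors: a
    late survival. *)
Lemma pair_solution_degree G p d : (0 < d)%N -> (2 * n <= size p)%N ->
  (forall v, ~~ occurs (late_survival G d v) [::] p) ->
  implicit_b_matching G d (pair_solution p).
Proof.
move=> d0 np no_late; apply/bigmax_leqP => v _; rewrite nbhd_pair_solution.
set D := [set _ in _ | _]%SET; rewrite leqNgt; apply/negP => dD.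
have /card_gt0P[u0 u0D] : (0 < #|D|)%N by apply: leq_trans dD.
case: (arg_maxnP (fun u : 'I_n => nat_of_ord u) u0D) => u uD umax.
have {}uD : u \in D by [].
(* A second neighbor [w] below [u] makes [u + v] positive, so that the preceding round exists. *)
have : (0 < #|(D :\ u)%SET|)%N.
  by move: dD; rewrite (cardsD1 u D) uD add1n ltnS; exact: leq_trans.
move=> /card_gt0P[w]; rewrite in_setD1 => /andP[wu wD].
have lt_u x : x \in (D :\ u)%SET -> (x < u)%N.
  rewrite in_setD1 => /andP[xu xD]; rewrite ltn_neqAle; apply/andP; split=> //.
  exact: umax.
have wltu : (w < u)%N by apply: lt_u; rewrite in_setD1 wu.
pose i := (u + v).-1.
have iE : i.+1 = (u + v)%N by rewrite prednK //; lia.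
have ip : (i < size p)%N.
  by rewrite iE (leq_trans _ np) //; have := ltn_ord u; have := ltn_ord v; lia.
have : alive (take i.+1 p) v.
  by move: (uD); rewrite /D !inE /kept iE => /and3P[].
rewrite alive_takeS // => /andP[ni iv].
have := no_late v; rewrite (@occurs_nth _ _ _ i [ffun=> None]) //.
rewrite /late_survival /= ni iv /=.
move: dD; rewrite (cardsD1 u D) uD add1n ltnS => /leq_trans; apply.
apply: subset_leq_card; apply/fintype.subsetP => x xD.
have xu := lt_u x xD; move: xD; rewrite in_setD1 => /andP[_].
rewrite /D !inE => /andP[-> kx] /=; rewrite size_takel; last exact: ltnW.
have xi : (x + v <= i)%N by rewrite -ltnS iE ltn_add2r.
by rewrite xi kept_take.
Qed.

(** * The algorithm, its privacy and its success probability *)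

Lemma stopping_halts G : mass (transcript_pmf stopping_strategy G) setT = 1%E.
Proof.
rewrite mass_transcript -(run_probT G T [::]); congr (_%:E).
by apply: eq_bigr => s _; rewrite in_setT.
Qed.

Definition stopping_algorithm : algorithm R 'I_n :=
  Algorithm stopping_halts (fun p v _ => [set u | kept p u v]%SET).

Lemma stopping_algorithm_ledp : ledp (e0 * 6%:R) stopping_algorithm.
Proof.
move=> G G' GG' A; rewrite !mass_transcript -EFinM lee_fin mulr_sumr.
apply: ler_sum => s _; rewrite mulrA ler_wpM2r //.
have := transcript_pmf_neighbor s GG'.
by rewrite /transcript_pmf !run_pmfE //= size_tuple eqxx !mul1r.
Qed.

Lemma billboard_prob_ge0 G A : (0 <= billboard_prob stopping_algorithm G A)%E.
Proof. by apply: esum_ge0 => s _; rewrite lee_fin run_pmf_ge0. Qed.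

Lemma stopping_algorithm_success G d' d : (0 < d)%N -> (2 * n <= T)%N ->
  ((1 - n%:R * (T%:R * (expR (e0 * d'%:R) / K)) -
    n%:R * (K * expR (- (e0 * d%:R))))%R%:E <=
   billboard_prob stopping_algorithm G
     [set p | implicit_b_matching G d (output stopping_algorithm G p) /\
        (2^-1 * (opt G d')%:R <=
          (implicit_size G (output stopping_algorithm G p))%:R :> R)%R])%E.
Proof.
move=> d0 nT; rewrite /billboard_prob mass_transcript lee_fin run_probC -addrA.
rewrite lerD2l -opprD lerN2.
pose bad (i : bool * 'I_n) : pred history :=
  if i.1 then occurs (early_stop G d' i.2) [::]
  else occurs (late_survival G d i.2) [::].
apply: (@le_trans _ _ (run_prob G T [::] (fun s => [exists i, bad i s]))).
  apply: run_prob_le => s sT /=; apply: contraR => /existsPn good.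
  rewrite inE /=; split.
    apply: pair_solution_degree => //; first by rewrite sT.
    by move=> v; exact: (good (false, v)).
  rewrite ler_pdivrMl // -natrM ler_nat.
  by apply: pair_solution_size => v; exact: (good (true, v)).
apply: le_trans (run_prob_union _ _ _ _) _.
rewrite -(pair_bigA _ (fun c v => run_prob G T [::] (bad (c, v)))) big_bool /=.
have cst (x : R) : n%:R * x = \sum_(v < n) x.
  by rewrite sumr_const card_ord mulr_natl.
rewrite !cst.
by apply: lerD; apply: ler_sum => v _; [exact: run_prob_early|exact: run_prob_late].
Qed.

End Protocol.

(** * Choice of the parameters *)

Theorem mainTheorem6 (R : realType) (c : R) (hc : 1 <= c) :
  exists C : R, 0 < C /\
  forall (n b' b : nat) (eps eta : R),
    (0 < n)%N -> 0 < eps < 1 -> 0 < eta < 1 -> (1 <= b')%N ->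
    (1 + eta) ^+ 2 / (1 - eta) * b'%:R + C * (ln n%:R / (eta ^+ 2 * eps))
      <= b%:R ->
    exists alg : algorithm R 'I_n,
      ledp eps alg /\
      forall G : sgraph 'I_n,
        ((1 - n%:R `^ (- c))%R%:E <=
         billboard_prob alg G
           [set p | implicit_b_matching G b (output alg G p) /\
              (2^-1 * (opt G b')%:R <= (implicit_size G (output alg G p))%:R :> R)%R])%E.
Proof.
(* This is [6 * (6 + 2 * c)]: the 6 undoes [e0 = eps / 6], and the late survivals require
   [expR (e0 * (b - b'))] to reach [n ^ (6 + 2 * c)]. *)
exists (36%:R + 12%:R * c); split; first by lra.
move=> n b' b eps eta n0 /andP[eps0 eps1] /andP[eta0 eta1] b'1 hb.
set L : R := ln n%:R in hb.
have nL : n%:R = expR L by rewrite lnK // posrE ltr0n.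
have L0 : 0 <= L by rewrite ln_ge0 // ler1n.
(* The coefficient of [b'] and [1 / eta ^+ 2] are at least 1, which leaves a purely additive gap. *)
have gap : (36%:R + 12%:R * c) * L <= eps * (b%:R - b'%:R).
  have fac : b'%:R <= (1 + eta) ^+ 2 / (1 - eta) * b'%:R.
    by rewrite ler_peMl // ler_pdivlMr ?subr_gt0 // mul1r; nra.
  have add : L / eps <= L / (eta ^+ 2 * eps).
    rewrite ler_wpM2l // lef_pV2 ?posrE ?mulr_gt0 ?exprn_gt0 //.
    by rewrite ler_piMl ?(ltW eps0) // exprn_ile1 ?ltW.
  rewrite -ler_pdivrMl // mulrC -mulrA.
  have C0 : 0 <= 36%:R + 12%:R * c by lra.
  have := ler_wpM2l C0 add; lra.
have b0 : (0 < b)%N.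
  rewrite -(ltr0n R); have : 1 <= b'%:R :> R by rewrite ler1n.
  have : 0 <= (36%:R + 12%:R * c) * L by rewrite mulr_ge0 //; lra.
  by move=> ge0; have := le_trans ge0 gap; rewrite pmulr_rge0 //; lra.
pose e0 := eps / 6%:R; have e00 : 0 <= e0 by rewrite divr_ge0 ?ltW.
(* [K] makes the early stops of the n nodes in the 2n rounds have total
   probability at most q / 2, where q = n^-c. *)
pose q := expR (- c * L); pose B := expR (e0 * b'%:R).
pose K := 4%:R * n%:R ^+ 2 / q * B.
have q0 : 0 < q by exact: expR_gt0.
have B0 : 0 < B by exact: expR_gt0.
have K0 : 0 < K by rewrite !mulr_gt0 ?invr_gt0 ?exprn_gt0 ?ltr0n.
exists (stopping_algorithm n (2 * n) e00 K0); split.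
  rewrite (_ : eps = e0 * 6%:R); last by rewrite divfK.
  exact: stopping_algorithm_ledp.
(* For [n = 1] the required probability is 0; otherwise 8 is at most [n ^ 3], as used in [big]. *)
move=> G; case: (ltnP 1 n) => [n1|]; last first.
  move=> n1; have -> : n%:R `^ (- c) = 1 :> R.
    by rewrite (_ : n = 1%N) ?powR1 //; apply/eqP; rewrite eqn_leq n1.
  by rewrite subrr; exact: billboard_prob_ge0.
apply: le_trans (stopping_algorithm_success e00 K0 G b' b0 (leqnn _)).
rewrite lee_fin -addrA lerD2l -opprD lerN2.
have nq : n%:R `^ (- c) = q by rewrite /powR pnatr_eq0 gtn_eqF.
rewrite nq.
have n_neq0 : n%:R != 0 :> R by rewrite pnatr_eq0 gtn_eqF.
have -> : n%:R * ((2 * n)%:R * (expR (e0 * b'%:R) / K)) = q / 2%:R.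
  rewrite -/B /K natrM; field.
  by rewrite n_neq0 !lt0r_neq0.
suff : n%:R * (K * expR (- (e0 * b%:R))) <= q / 2%:R by lra.
have big : 8%:R * n%:R ^+ 3 / q ^+ 2 * (B * expR (- (e0 * b%:R))) <= 1.
  rewrite [leRHS](_ : 1 =
    n%:R ^+ 6 / q ^+ 2 * expR (- ((6%:R + 2%:R * c) * L))); last first.
    rewrite nL /q -!expRM_natr -expRN -!expRD -[LHS]expR0.
    by congr expR; ring.
  apply: ler_pM.
  - by rewrite !mulr_ge0 ?invr_ge0 ?exprn_ge0 // ltW.
  - by rewrite mulr_ge0 ?expR_ge0 // ltW.
  - rewrite ler_wpM2r ?invr_ge0 ?exprn_ge0 ?(ltW q0) //.
    rewrite (_ : 6 = 3 + 3)%N // exprD ler_wpM2r ?exprn_ge0 //.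
    by rewrite -natrX ler_nat (@leq_exp2r 2 n 3).
  - have e0E : e0 * b%:R - e0 * b'%:R = eps * (b%:R - b'%:R) / 6%:R.
      by rewrite /e0; field.
    rewrite /B -expRD ler_expR; move: gap; lra.
rewrite [leLHS](_ : _ = q / 2%:R * (8%:R * n%:R ^+ 3 / q ^+ 2 *
  (B * expR (- (e0 * b%:R))))).
  by rewrite ler_piMr // divr_ge0 // ltW.
by rewrite /K; field; rewrite lt0r_neq0.
Qed.
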